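(* For $n\ge0$ and $0\le k\le\lfloor n/2\rfloor$, $$E_{n,k}(h\,|\,p,q)=\sum_{\sigma\in\mathcal{A}^2_{n+1,\mathrm{des}=k}}h^{\mathrm{D}(\sigma)}p^{(31-2)(\sigma)-\mathrm{des}(\sigma)}q^{(2-13)(\sigma)}.$$
   Context: $\mathfrak{S}_N$ is the set of permutations $\sigma=\sigma_1\cdots\sigma_N$ of $[N]$. With the convention $\sigma_0=\sigma_{N+1}=0$, a letter $\sigma_i$ ($i\in[N]$) is a valley if $\sigma_{i-1}>\sigma_i<\sigma_{i+1}$, a peak if $\sigma_{i-1}<\sigma_i>\sigma_{i+1}$, a double descent if $\sigma_{i-1}>\sigma_i>\sigma_{i+1}$. $\mathrm{Val}(\sigma)$, $\mathrm{Pk}(\sigma)$ are the sets of letters that are valleys, peaks; $\mathrm{dd}(\sigma)$ is the number of double descents; $\mathrm{des}(\sigma)=\#\{1\le i\le N-1:\sigma_i>\sigma_{i+1}\}$. For $\sigma\in\mathfrak{S}_N$, $\mathrm{D}(\sigma)=\sum_{i\in\mathrm{Pk}(\sigma)\setminus\{N\}}i-\sum_{j\in\mathrm{Val}(\sigma)}j$. $(31\!-\!2)(\sigma)$ is the number of pairs $i<j\le N$ with $\sigma_i>\sigma_j>\sigma_{i+1}$; $(2\!-\!13)(\sigma)$ is the number of pairs $i<j<N$ with $\sigma_j<\sigma_i<\sigma_{j+1}$. $E_{n,k}(h\,|\,p,q)$ is the polynomial (it is known to be a polynomial with nonnegative integer coefficients) defined by $$\sum_{\sigma\in\mathfrak{S}_{n+1},\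 \mathrm{dd}(\sigma)=0,\ \mathrm{des}(\sigma)=k}h^{\mathrm{D}(\sigma)}p^{(31-2)(\sigma)}q^{(2-13)(\sigma)}=(p+q)^k\,E_{n,k}(h\,|\,p,q).$$ For $x=\sigma_i$, the $x$-factorization of $\sigma$ is $\sigma=u\,\lambda(x)\,x\,\rho(x)\,v$, where $\lambda(x)$ (resp. $\rho(x)$) is the maximal (possibly empty) contiguous factor immediately to the left (resp. right) of $x$ all of whose letters are larger than $x$. A permutation $\sigma\in\mathfrak{S}_N$ is an André permutation of the second kind if it has no double descents and, for every letter $x$: $\lambda(x)=\emptyset$ if $\rho(x)=\emptyset$, and $\min\rho(x)<\min\lambda(x)$ if both $\lambda(x)$ and $\rho(x)$ are nonempty. $\mathcal{A}^2_{N,\mathrm{des}=k}$ is the set of André permutations of the second kind in $\mathfrak{S}_N$ with $\mathrm{des}(\sigma)=k$. *)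

(* Defs.v *)
From HB Require Import structures.
From mathcomp Require Import all_boot all_order all_fingroup all_algebra.
From mathcomp Require Export fraction mpoly.
From Stdlib Require Export ClassicalEpsilon.
Set Implicit Arguments.
Unset Strict Implicit.
Unset Printing Implicit Defensive.
Import Order.TTheory GRing.Theory Num.Theory.

(* The one-line notation of [s], with letters in 1, ..., N instead of 'I_N. *)
Definition word (N : nat) (s : 'S_N) : seq nat :=
  [seq (val (s i)).+1 | i <- enum 'I_N].

(* Positions are 1-based; positions 0 and N+1 carry the value 0. *)
Definition letter (w : seq nat) (i : nat) : nat := nth 0 (0 :: w) i.

Definition valley (w : seq nat) (i : nat) : bool :=
  (letter w i.-1 > letter w i) && (letter w i < letter w i.+1).

Definition peak (w : seq nat) (i : nat) : bool :=
  (letter w i.-1 < letter w i) && (letter w i > letter w i.+1).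

Definition ddescent (w : seq nat) (i : nat) : bool :=
  (letter w i.-1 > letter w i) && (letter w i > letter w i.+1).

(* Letters of a permutation are distinct, so these lists are duplicate-free
   and stand for sets of letters. *)
Definition Val (w : seq nat) : seq nat :=
  [seq letter w i | i <- index_iota 1 (size w).+1 & valley w i].

Definition Pk (w : seq nat) : seq nat :=
  [seq letter w i | i <- index_iota 1 (size w).+1 & peak w i].

Definition dd (w : seq nat) : nat :=
  \sum_(1 <= i < (size w).+1 | ddescent w i) 1.

Definition des (w : seq nat) : nat :=
  \sum_(1 <= i < size w | letter w i > letter w i.+1) 1.

Definition D (w : seq nat) : int :=
  (\sum_(x <- Pk w | x != size w) x%:Z - \sum_(x <- Val w) x%:Z)%R.

(* (31-2) *)
Definition vin31_2 (w : seq nat) : nat :=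
  \sum_(1 <= i < (size w).+1) \sum_(i.+1 <= j < (size w).+1 |
     (letter w i > letter w j) && (letter w j > letter w i.+1)) 1.

(* (2-13) *)
Definition vin2_13 (w : seq nat) : nat :=
  \sum_(1 <= i < size w) \sum_(i.+1 <= j < size w |
     (letter w j < letter w i) && (letter w i < letter w j.+1)) 1.

Definition prefix_gt (x : nat) (s : seq nat) : seq nat :=
  take (find (fun y => y <= x) s) s.

Definition lambda (w : seq nat) (x : nat) : seq nat :=
  rev (prefix_gt x (rev (take (index x w) w))).

Definition rho (w : seq nat) (x : nat) : seq nat :=
  prefix_gt x (drop (index x w).+1 w).

(* Only used on nonempty sequences. *)
Definition min_letter (s : seq nat) : nat := foldr minn (head 0 s) s.

Definition andre2 (w : seq nat) : bool :=
  (dd w == 0) &&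
  all (fun x =>
         ((rho w x == [::]) ==> (lambda w x == [::])) &&
         ((rho w x != [::]) && (lambda w x != [::]) ==>
            (min_letter (rho w x) < min_letter (lambda w x)))) w.

Local Open Scope ring_scope.

Notation ZPoly := {mpoly int[3]}.
Notation ZFrac := {fraction {mpoly int[3]}}.

(* The three indeterminates, in the fraction field of Z[h, p, q], where
   integer (possibly negative) exponents make sense. *)
Definition h : ZFrac := tofrac ('X_(inord 0) : ZPoly).
Definition p : ZFrac := tofrac ('X_(inord 1) : ZPoly).
Definition q : ZFrac := tofrac ('X_(inord 2) : ZPoly).

Definition is_E (n k : nat) (P : ZPoly) : Prop :=
  \sum_(s : 'S_n.+1 | (dd (word s) == 0)%N && (des (word s) == k))
     h ^ D (word s) * p ^+ vin31_2 (word s) * q ^+ vin2_13 (word s)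
  = (p + q) ^+ k * tofrac P.

(* The polynomial E_{n,k}(h | p, q); [is_E n k] has at most one solution, by
   [is_E_unique] below. *)
Definition E (n k : nat) : ZPoly := epsilon (inhabits 0) (is_E n k).

Lemma is_E_unique (n k : nat) (P Q : ZPoly) : is_E n k P -> is_E n k Q -> P = Q.
Proof.
rewrite /is_E => -> /esym H; apply/eqP; rewrite -tofrac_eq; apply/eqP.
suff pq0 : (p + q) ^+ k != 0 by exact/esym/(mulfI pq0).
rewrite expf_neq0 // /p /q -tofracD tofrac_eq0; apply/eqP.
move=> /(congr1 (mcoeff U_(inord 1))).
by rewrite mcoeffD !mcoeffXU mcoeff0 eqxx -val_eqE /= !inordK.
Qed.

(* Main.v *)
Require Import Defs.
From mathcomp Require Import all_boot all_order all_fingroup all_algebra.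
From mathcomp Require Import ring zify.
Import GRing.Theory Num.Theory.
Local Open Scope ring_scope.

(** The idea is to build a permutation by inserting its letters from the
    largest to the smallest and to follow the maximal factors (blocks) formed
    by the letters present.  A peak opens a new block, a double ascent is put
    in front of a block, and a valley joins two adjacent blocks; a double
    descent would be put at the end of a block and never occurs.  If the new
    letter ends up in the block of rank j (from 0) among m blocks, then there
    are exactly j descents to its left and m - 1 - j ascents to its right that
    straddle it, so the insertion contributes p^j q^(m-1-j) whatever its kind,
    and h^x, 1 or h^-x according to the kind.  The words obtained are exactly
    those without double descent ([mem_states]), and the Andre words of the
    second kind are those for which every valley joins two blocks the right one
    of which has the smaller minimum.

    So consider the sequence of minima of the blocks.  Put r = p / (p + q).
    The theorem says that imposing the Andre condition multiplies the total
    weight by r^k, one factor r per valley.  One would like each adjacent pair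
    of minima to be a descent with probability r, independently; this is false,
    but it does hold for families of pairwise disjoint adjacent pairs, and this
    is all that is needed.  A family of disjoint adjacent pairs among m blocks
    is a composition of m in parts 1 and 2, encoded by a list of booleans, and
    [total_matches] says that asking each pair of the family to be a descent
    multiplies the weight by one factor r per pair, and the Andre condition by
    one factor r per valley.  The induction works because the new letter is the
    smallest of all minima.  If its block is in no pair, the three kinds of
    insertion correspond to deleting this part, keeping it, or replacing it by
    a pair: the condition that allows the join is itself of the prescribed
    form.  If its block is in a pair, it has to be the right member, and then
    the other member becomes a part 1; of the two ranks i and i+1 the second is
    selected, and p^(i+1) q^(m-2-i) = r (p^i q^(m-1-i) + p^(i+1) q^(m-2-i)),
    which produces the factor of this pair ([unmin_sum]).

    The statistics are computed on the word in which the blocks are separated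
    and surrounded by zeros: inserting a letter x amounts to replacing one zero
    by x, 0x or x between two zeros.  In such a word the sum of all drops
    a - b over descents ab telescopes to the sum of the peaks minus the sum of
    the valleys ([drops_D]).  Finally, in an Andre permutation each descent ab
    has a letter between a and b to its right ([des_le_vin31]), so that the sum
    on the right-hand side is a polynomial; it is therefore the polynomial that
    defines E. *)

(** * Words padded with zeros and their statistics *)

Section Words.
Local Open Scope nat_scope.

Fixpoint pairsum (f : nat -> nat -> nat) (z : seq nat) : nat :=
  if z is a :: z' then (if z' is b :: _ then f a b else 0) + pairsum f z' else 0.

Definition straddle (y : nat) := pairsum (fun a b => (a < y) && (y < b)).
Definition descents := pairsum (fun a b => b < a).
Definition drops := pairsum subn.
Arguments straddle : simpl never.
Arguments descents : simpl never.
Arguments drops : simpl never.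

(** The pairs (2-13) grouped by their letter 2.  In words padded with zeros the
    zeros never play the part of the 2. *)
Fixpoint occ2_13 (z : seq nat) : nat :=
  if z is y :: z' then straddle y z' + occ2_13 z' else 0.
(** The pattern (31-2) is the reverse of (2-13); with this definition each
    lemma on one of them serves for the other. *)
Definition occ31_2 (z : seq nat) : nat := occ2_13 (rev z).

Lemma pairsum_cat f A a B :
  pairsum f (A ++ a :: B) = pairsum f (rcons A a) + pairsum f (a :: B).
Proof.
elim: A => [|c A IH] //; rewrite cat_cons rcons_cons.
by case: A IH => [|d A] /= IH; rewrite ?addn0 // IH addnA.
Qed.

Lemma eq_pairsum_rcons f A a b :
  (forall c, f c a = f c b) -> pairsum f (rcons A a) = pairsum f (rcons A b).
Proof.
move=> fab; elim: A => [|c A IH] //; rewrite !rcons_cons /=.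
by rewrite IH; case: A {IH} => [|d A] /=; rewrite ?fab.
Qed.

Lemma straddle0 z : straddle 0 z = 0.
Proof. by rewrite /straddle; elim: z => // a z /= ->; case: z. Qed.

(** No letter y > x distinguishes x from 0. *)
Lemma straddle_subst y x (b1 b2 : bool) A B : 0 < x < y ->
  straddle y (A ++ nseq b1 0 ++ x :: nseq b2 0 ++ B) = straddle y (A ++ 0 :: B).
Proof.
move=> /andP[x0 xy]; have y0 := ltn_trans x0 xy.
have sx A' C : straddle y (A' ++ x :: C) = straddle y (A' ++ 0 :: C).
  rewrite /straddle !pairsum_cat; congr (_ + _).
    by apply: eq_pairsum_rcons => c; rewrite ltn0 [y < x]ltnNge (ltnW xy) !andbF.
  by case: C => [|c C] //=; rewrite xy y0.
have s00 C : straddle y (A ++ 0 :: 0 :: C) = straddle y (A ++ 0 :: C).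
  by rewrite /straddle !pairsum_cat /= ltn0 andbF add0n.
have s0x C : straddle y (A ++ 0 :: x :: C) = straddle y (A ++ 0 :: C).
  by rewrite -cat_rcons sx cat_rcons s00.
by case: b1; case: b2 => /=; rewrite ?s0x ?sx ?s00.
Qed.

(** Replacing a 0 by x, 0x, x0 or 0x0 with x smaller than all letters present
    leaves the contribution of these letters unchanged, so only the new letter
    x counts. *)
Lemma occ2_13_subst x (b1 b2 : bool) A B : 0 < x ->
  all (fun y => (y == 0) || (x < y)) A ->
  occ2_13 (A ++ nseq b1 0 ++ x :: nseq b2 0 ++ B)
  = occ2_13 (A ++ 0 :: B) + straddle x (nseq b2 0 ++ B).
Proof.
move=> x0; elim: A => [_|y A IH /= /andP[xy /IH ->]].
  by case: b1; case: b2; rewrite /= ?straddle0 ?add0n addnC.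
rewrite -addnA; congr (_ + _).
case/orP: xy => [/eqP->|xy]; first by rewrite !straddle0.
by rewrite straddle_subst ?x0.
Qed.

Lemma occ31_2_subst x (b1 b2 : bool) A B : 0 < x ->
  all (fun y => (y == 0) || (x < y)) B ->
  occ31_2 (A ++ nseq b1 0 ++ x :: nseq b2 0 ++ B)
  = occ31_2 (A ++ 0 :: B) + straddle x (rev (A ++ nseq b1 0)).
Proof.
move=> x0 xB.
have rn (b : bool) : rev (nseq b 0) = nseq b 0 by case: b.
rewrite /occ31_2 !rev_cat /= !rev_cons !rev_cat !rn -!cats1 -!catA /=.
by rewrite occ2_13_subst ?all_rev.
Qed.

End Words.

Section Blocks.
Local Open Scope nat_scope.

Definition flat (bs : seq (seq nat)) : seq nat := flatten [seq 0 :: b | b <- bs].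
(** The blocks separated and surrounded by zeros, with the single word 0 for the
    empty list of blocks. *)
Definition padded bs := rcons (flat bs) 0.
Arguments flat : simpl never.
Arguments padded : simpl never.

Definition above x (bs : seq (seq nat)) :=
  all (fun b => (b != [::]) && all (ltn x) b) bs.

Lemma flat_cat A B : flat (A ++ B) = flat A ++ flat B.
Proof. by rewrite /flat map_cat flatten_cat. Qed.

Lemma padded_cat A B : padded (A ++ B) = flat A ++ padded B.
Proof. by rewrite /padded flat_cat rcons_cat. Qed.

Lemma padded_cons b B : padded (b :: B) = 0 :: b ++ padded B.
Proof. by rewrite /padded /flat /= rcons_cat. Qed.

Lemma padded_head B : padded B = 0 :: behead (padded B).
Proof. by case: B. Qed.

Lemma all_padded x bs : above x bs -> all (fun y => (y == 0) || (x < y)) (padded bs).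
Proof.
elim: bs => [|b bs IH] // /andP[/andP[_ xb] /IH {}IH].
rewrite padded_cons [all _ _]/= all_cat IH.
by rewrite andbT; apply: sub_all xb => y /= ->; rewrite orbT.
Qed.

Lemma rev_flat bs : rev (flat bs) = behead (padded (rev [seq rev b | b <- bs])).
Proof.
elim: bs => [|b bs IH] //.
rewrite {1}/flat /= rev_cons rev_cat -/(flat bs) IH rev_cons -[rcons (rev _) _]cats1.
rewrite padded_cat padded_cons.
by rewrite /padded; case: (rev _) => [|c C]; rewrite /flat /= ?cats1 // -!cats1 -!catA.
Qed.

Lemma rev_padded bs : rev (padded bs) = padded (rev [seq rev b | b <- bs]).
Proof. by rewrite rev_rcons rev_flat -padded_head. Qed.

Lemma straddle_skip x b z : all (ltn x) b -> straddle x (b ++ 0 :: z) = straddle x (0 :: z).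
Proof.
rewrite /straddle; elim: b => [|a b IH] // /andP[xa xb].
by rewrite -(IH xb); case: b {IH xb} => [|c b]; rewrite /= [a < x]ltnNge ltnW.
Qed.

(** Each block is entered by one ascent from 0, which straddles x, and all the
    other adjacent pairs are on one side of x or descend. *)
Lemma straddle_padded x bs : 0 < x -> above x bs -> straddle x (padded bs) = size bs.
Proof.
move=> x0; elim: bs => [|b bs IH] //= /andP[/andP[bn xb] xbs].
have {}IH : straddle x (b ++ padded bs) = size bs.
  by rewrite padded_head straddle_skip // -padded_head IH.
rewrite padded_cons; case: b bn xb IH => // a b _ /andP[/= xa _] <-.
by rewrite /straddle /= x0 xa.
Qed.

Lemma straddle_rev_padded x bs : 0 < x -> above x bs -> straddle x (rev (padded bs)) = size bs.
Proof.
move=> x0 xbs; rewrite rev_padded straddle_padded ?size_rev ?size_map //.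
rewrite /above all_rev all_map; apply: sub_all xbs => b /= /andP[bn xb].
by rewrite all_rev xb andbT -size_eq0 size_rev size_eq0.
Qed.

Section Step.
Variables (x : nat) (A B : seq (seq nat)).
Hypotheses (x0 : 0 < x) (xA : above x A) (xB : above x B).

Let aA : all (fun y => (y == 0) || (x < y)) (flat A).
Proof. by have := all_padded _ _ xA; rewrite /padded all_rcons. Qed.
Let aB : all (fun y => (y == 0) || (x < y)) (padded B).
Proof. exact: all_padded. Qed.
Let aO L : all (ltn x) L -> all (fun y => (y == 0) || (x < y)) L.
Proof. by apply: sub_all => y /= ->; rewrite orbT. Qed.

(** The three lemmas below give the effect of inserting the least letter x as a
    peak, a double ascent or a valley.  In all cases the blocks on the left
    count for (31-2) and those on the right for (2-13). *)
Lemma stats_peak :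
  [/\ occ31_2 (padded (A ++ [:: x] :: B)) = occ31_2 (padded (A ++ B)) + size A,
      occ2_13 (padded (A ++ [:: x] :: B)) = occ2_13 (padded (A ++ B)) + size B,
      descents (padded (A ++ [:: x] :: B)) = (descents (padded (A ++ B))).+1 &
      drops (padded (A ++ [:: x] :: B)) = drops (padded (A ++ B)) + x].
Proof.
rewrite !padded_cat padded_cons /=.
have eB := padded_head B; move: (behead _) aB eB => Z aZ eB; rewrite eB in aZ *.
have E1 := occ31_2_subst x true true (flat A) Z x0 aZ.
have E2 := occ2_13_subst x true true (flat A) Z x0 aA.
rewrite /= cats1 -/(padded A) straddle_rev_padded // in E1.
rewrite /= -eB straddle_padded // eB in E2.
split=> //; rewrite /descents /drops !pairsum_cat /= ?ltn0 ?x0; lia.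
Qed.

Lemma stats_ascent R : R != [::] -> all (ltn x) R ->
  [/\ occ31_2 (padded (A ++ (x :: R) :: B)) = occ31_2 (padded (A ++ R :: B)) + size A,
      occ2_13 (padded (A ++ (x :: R) :: B)) = occ2_13 (padded (A ++ R :: B)) + size B,
      descents (padded (A ++ (x :: R) :: B)) = descents (padded (A ++ R :: B)) &
      drops (padded (A ++ (x :: R) :: B)) = drops (padded (A ++ R :: B))].
Proof.
move=> Rn xR; rewrite !padded_cat !padded_cons /=.
have aR : all (fun y => (y == 0) || (x < y)) (R ++ padded B) by rewrite all_cat aO ?aB.
have E1 := occ31_2_subst x true false (flat A) _ x0 aR.
have E2 := occ2_13_subst x true false (flat A) (R ++ padded B) x0 aA.
rewrite /= cats1 -/(padded A) straddle_rev_padded // in E1.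
rewrite /= [in straddle _ _]padded_head straddle_skip // -padded_head straddle_padded // in E2.
split=> //; rewrite /descents /drops !pairsum_cat.
  case: R Rn xR {aR E1 E2} => //= b R _ /andP[xb _]; lia.
case: R Rn xR {aR E1 E2} => //= b R _ /andP[xb _]; lia.
Qed.

Lemma stats_valley L R : L != [::] -> all (ltn x) L -> R != [::] -> all (ltn x) R ->
  [/\ occ31_2 (padded (A ++ (L ++ x :: R) :: B)) = occ31_2 (padded (A ++ L :: R :: B)) + size A,
      occ2_13 (padded (A ++ (L ++ x :: R) :: B)) = occ2_13 (padded (A ++ L :: R :: B)) + size B,
      descents (padded (A ++ (L ++ x :: R) :: B)) = descents (padded (A ++ L :: R :: B)) &
      drops (padded (A ++ (L ++ x :: R) :: B)) + x = drops (padded (A ++ L :: R :: B))].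
Proof.
move=> Ln xL Rn xR; rewrite !padded_cat !padded_cons /=.
have aR : all (fun y => (y == 0) || (x < y)) (R ++ padded B) by rewrite all_cat aO ?aB.
have aL : all (fun y => (y == 0) || (x < y)) (padded A ++ L).
  by rewrite all_cat all_padded ?aO.
have assoc M : flat A ++ 0 :: L ++ M = (padded A ++ L) ++ M.
  by rewrite /padded cat_rcons -catA.
have E1 := occ31_2_subst x false false (padded A ++ L) _ x0 aR.
have E2 := occ2_13_subst x false false (padded A ++ L) (R ++ padded B) x0 aL.
rewrite /= cats0 rev_cat rev_padded [in straddle _ _]padded_head in E1.
rewrite straddle_skip ?all_rev // -padded_head -rev_padded straddle_rev_padded // in E1.
rewrite /= [in straddle _ _]padded_head straddle_skip // -padded_head straddle_padded // in E2.
rewrite -(catA L) cat_cons !assoc.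
split=> //.
  rewrite /descents; move: Ln Rn xL xR {aL aR assoc E1 E2}.
  case: (lastP L) => // L' a _; case: R => // b R' _.
  rewrite all_rcons => /andP[/= xa _] /andP[/= xb _].
  rewrite -!rcons_cat !cat_rcons !(pairsum_cat _ _ a) /= xa (ltn_trans x0 xa).
  by rewrite [b < x]ltnNge ltnW.
rewrite /drops; move: Ln Rn xL xR {aL aR assoc E1 E2}.
case: (lastP L) => // L' a _; case: R => // b R' _.
rewrite all_rcons => /andP[/= xa _] /andP[/= xb _].
rewrite -!rcons_cat !cat_rcons !(pairsum_cat _ _ a) /=.
have -> : x - b = 0 by apply/eqP; rewrite subn_eq0 ltnW.
have : a - x + x = a by rewrite subnK // ltnW.
lia.
Qed.

End Step.
End Blocks.

(** * Decomposition of a word at its least letter *)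

Set Implicit Arguments.
Unset Strict Implicit.

Section Locality.
Local Open Scope nat_scope.
Implicit Types (w L R b : seq nat) (c : seq nat -> seq nat -> bool).

(** Both the absence of double descents and the Andre condition have this
    form. *)
Definition locally c w := all (fun x => c (lambda w x) (rho w x)) w.

Lemma prefix_gt_nil x s : (prefix_gt x s == [::]) = (head 0 s <= x).
Proof. by case: s => [|a s] //=; rewrite /prefix_gt /=; case: (a <= x). Qed.

Lemma prefix_gt_all x s : all (ltn x) s -> prefix_gt x s = s.
Proof.
rewrite /prefix_gt => xs; rewrite take_oversize // leqNgt -has_find -all_predC.
by apply: sub_all xs => y /=; rewrite ltnNge.
Qed.

Lemma prefix_gt_cut x y s t : x <= y -> prefix_gt y (s ++ x :: t) = prefix_gt y s.
Proof.
move=> xy; rewrite /prefix_gt find_cat; case: ifP => ys.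
  by rewrite take_cat -has_find ys.
by rewrite /= xy addn0 take_size_cat // take_oversize // leqNgt -has_find ys.
Qed.

(** The factors lambda and rho of a letter of L or R stop at x, hence are those
    computed inside L or R: a local condition is a condition at each node of
    the increasing binary tree of the word. *)
Lemma locally_cut c x L R : uniq (L ++ x :: R) ->
  all (ltn x) L -> all (ltn x) R ->
  locally c (L ++ x :: R) = [&& c L R, locally c L & locally c R].
Proof.
move=> U xL xR; rewrite /locally all_cat /= andbCA; congr (_ && (_ && _)).
- have xnL : x \notin L.
    by apply/negP => /(allP xL) /=; rewrite ltnn.
  rewrite /lambda /rho index_cat (negbTE xnL) /= eqxx addn0.
  rewrite take_size_cat // -cat_rcons drop_size_cat ?size_rcons //.
  by rewrite !prefix_gt_all ?all_rev // revK.
- apply: eq_in_all => y yL; have /ltnW xy : x < y := allP xL _ yL.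
  rewrite /lambda /rho index_cat yL.
  have iy : index y L < size L by rewrite index_mem.
  rewrite take_cat drop_cat iy; case: (ltngtP (index y L).+1 (size L)) => Sy.
  + by rewrite prefix_gt_cut.
  + by move: Sy; rewrite ltnNge iy.
  + by rewrite Sy subnn drop0 drop_size -(prefix_gt_cut [::] R xy).
- apply: eq_in_all => y yR; have xy : x < y := allP xR _ yR.
  have ynL : y \notin L.
    apply/negP => yL; move: U; rewrite cat_uniq => /and3P[_ /hasPn/(_ y) H _].
    by move: H; rewrite inE yR orbT yL => /(_ isT).
  rewrite /lambda /rho index_cat (negbTE ynL) /= (ltn_eqF xy).
  rewrite -cat_rcons -addSnnS -(size_rcons L x) -addnS take_cat drop_cat.
  rewrite !ltnNge !leq_addr /= !addKn rev_cat rev_rcons.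
  by rewrite (prefix_gt_cut _ _ (ltnW xy)).
Qed.

Lemma foldr_minn_ge x d s : x <= d -> all (leq x) s -> x <= foldr minn d s.
Proof. by move=> xd; elim: s => //= a s IH /andP[xa /IH]; rewrite leq_min xa. Qed.

Lemma foldr_minn_le x d s : x \in s -> foldr minn d s <= x.
Proof.
by elim: s => //= a s IH; rewrite inE geq_min => /orP[/eqP->|/IH ->]; rewrite ?leqnn ?orbT.
Qed.

Lemma min_letter_gt x b : b != [::] -> all (ltn x) b -> x < min_letter b.
Proof. by case: b => // a b _ H; apply: foldr_minn_ge => //; case/andP: H. Qed.

Lemma min_letter_root x L R : all (ltn x) L -> all (ltn x) R ->
  min_letter (L ++ x :: R) = x.
Proof.
move=> xL xR; apply/eqP; rewrite eqn_leq foldr_minn_le ?mem_cat ?inE ?eqxx ?orbT //=.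
have H : all (leq x) (L ++ x :: R).
  rewrite all_cat /= leqnn.
  by rewrite !(sub_all _ xL, sub_all _ xR) // => y /ltnW.
by apply: foldr_minn_ge => //; case: L {xL} H => [|a L] //= /andP[].
Qed.

End Locality.

Section Patterns.
Local Open Scope nat_scope.

(** A pattern is a composition with parts 1 ([false], an unconstrained block)
    and 2 ([true], two adjacent blocks whose minima form a descent), so that the
    constrained pairs are disjoint by construction. *)
Fixpoint matches (e : seq bool) (bs : seq (seq nat)) : bool :=
  match e, bs with
  | [::], [::] => true
  | false :: e', _ :: bs' => matches e' bs'
  | true :: e', b1 :: b2 :: bs' => (min_letter b2 < min_letter b1) && matches e' bs'
  | _, _ => false
  end.

Fixpoint width (e : seq bool) : nat :=
  if e is b :: e' then b.+1 + width e' else 0.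

(** What remains of the pattern e around the block of rank j when this block
    has the least minimum: the parts before and after it.  It is [None] when
    that block is the left member of a pair, which then is no descent; when it
    is the right member, the left one becomes unconstrained. *)
Fixpoint unmin (e : seq bool) (j : nat) : option (seq bool * seq bool) :=
  match e, j with
  | false :: e', 0 => Some ([::], e')
  | true :: e', 1 => Some ([:: false], e')
  | false :: e', j'.+1 =>
      if unmin e' j' is Some (e1, e2) then Some (false :: e1, e2) else None
  | true :: e', j'.+2 =>
      if unmin e' j' is Some (e1, e2) then Some (true :: e1, e2) else None
  | _, _ => None
  end.

Lemma width_cat e1 e2 : width (e1 ++ e2) = width e1 + width e2.
Proof. by elim: e1 => //= b e1 ->; rewrite addnA. Qed.

Lemma matches_size e bs : matches e bs -> size bs = width e.
Proof.
elim: e bs => [|[] e IH] [|b1 bs] //=; last by move/IH->.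
by case: bs => // b2 bs /andP[_ /IH /= ->].
Qed.

Lemma matches_cat e1 e2 A B : size A = width e1 ->
  matches (e1 ++ e2) (A ++ B) = matches e1 A && matches e2 B.
Proof.
elim: e1 A => [|[] e1 IH] [|b1 A] //=; last by case=> /IH.
by case: A => // b2 A [/IH /= ->]; rewrite andbA.
Qed.

Lemma unmin_width e j e1 e2 : unmin e j = Some (e1, e2) ->
  width e1 = j /\ width e = j.+1 + width e2.
Proof.
elim: e j e1 => [|[] e IH] [|j] e1 //=.
- case: j => [|j]; first by case=> <- <-.
  case: (unmin e j) (IH j) => // -[f1 f2] /(_ f1) H [<- E]; move: H; rewrite E.
  by case=> //= -> ->.
- by case=> <- <-.
- case: (unmin e j) (IH j) => // -[f1 f2] /(_ f1) H [<- E]; move: H; rewrite E.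
  by case=> //= -> ->.
Qed.

Lemma matches_unmin x e A X B : min_letter X = x -> above x A -> above x B ->
  matches e (A ++ X :: B) =
  if unmin e (size A) is Some (e1, e2) then matches e1 A && matches e2 B else false.
Proof.
move=> mX; elim: e A => [|[] e IH] [|a A] //= xA xB.
- case: B xB {IH} => // b B /= /andP[/andP[bn xb] _].
  by rewrite mX ltnNge ltnW ?min_letter_gt.
- case/andP: xA => /andP[an xa] xA; case: A xA => [|a' A] /= xA.
    by rewrite mX min_letter_gt.
  case/andP: xA => _ xA; rewrite IH //.
  case: (unmin e (size A)) => [[e1 e2]|]; last by rewrite andbF.
  by rewrite /= andbA.
- case/andP: xA => _ xA; rewrite IH //.
  by case: (unmin e (size A)) => [[e1 e2]|].
Qed.

(** Here M is what stood in place of X before the insertion of x: no block, one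
    block, or two blocks whose minima form a descent. *)
Lemma matches_remin x e A X B mid M : min_letter X = x -> above x A -> above x B ->
  matches mid M ->
  matches e (A ++ X :: B) =
  if unmin e (size A) is Some (e1, e2) then matches (e1 ++ mid ++ e2) (A ++ M ++ B)
  else false.
Proof.
move=> mX xA xB mM; rewrite (matches_unmin _ mX) //.
case E: (unmin e (size A)) => [[e1 e2]|] //; have [w1 _] := unmin_width E.
by rewrite !matches_cat ?w1 ?(matches_size mM) // mM.
Qed.

End Patterns.

Section PatternWeight.
Variables (K : fieldType) (p q r : K).
Hypothesis r_def : r * (p + q) = p.

(** A part 2 at ranks i and i+1 keeps only the rank i+1 and loses one factor r,
    which balances since
    p^(i+1) q^(m-2-i) = r (p^i q^(m-1-i) + p^(i+1) q^(m-2-i)). *)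
Lemma unmin_sum e :
  \sum_(j < width e) (if unmin e j is Some (e1, e2)
     then p ^+ j * q ^+ (width e - j.+1) * r ^+ (count id e1 + count id e2) else 0)
  = r ^+ count id e * \sum_(j < width e) p ^+ j * q ^+ (width e - j.+1).
Proof.
elim: e => [|[] e IH] /=; first by rewrite !big_ord0 mulr0.
- rewrite !big_ord_recl /= /bump /= !add1n !add0n add0r.
  transitivity (p * q ^+ width e * r ^+ count id e + p ^+ 2 * (r *
    \sum_(j < width e) (if unmin e j is Some (e1, e2)
     then p ^+ j * q ^+ (width e - j.+1) * r ^+ (count id e1 + count id e2) else 0))).
    rewrite !subSS subn0 expr1; congr (_ + _); rewrite mulrCA !mulr_sumr.
    apply: eq_bigr => j _; rewrite !add0n !add1n !subSS.
    case: (unmin e j) => [[e1 e2]|]; last by rewrite !mulr0.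
    rewrite /= add1n addSn !exprS; ring.
  rewrite IH.
  under [in RHS]eq_bigr => j _ do rewrite !add1n !subSS !exprS -!mulrA.
  rewrite -!mulr_sumr !subSS !subn0 !exprS expr0 mul1r mulr1.
  have -> : p * q ^+ width e * r ^+ count id e
          = r * (p + q) * q ^+ width e * r ^+ count id e by rewrite r_def.
  ring.
- rewrite !big_ord_recl /= !add1n !add0n subSS subn0 expr0 !mul1r mulrDr mulrC.
  congr (_ + _).
  transitivity (p * \sum_(j < width e) (if unmin e j is Some (e1, e2)
     then p ^+ j * q ^+ (width e - j.+1) * r ^+ (count id e1 + count id e2) else 0)).
    rewrite mulr_sumr; apply: eq_bigr => j _; rewrite /bump /= !add1n !subSS.
    case: (unmin e j) => [[e1 e2]|]; last by rewrite !mulr0.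
    by rewrite /= add0n exprS !mulrA.
  rewrite IH mulrCA mulr_sumr; congr (_ * _).
  by apply: eq_bigr => j _; rewrite /bump /= !add1n !subSS exprS mulrA.
Qed.

End PatternWeight.

(** * Block lists built by inserting the letters in decreasing order *)

Section States.
Local Open Scope nat_scope.
Implicit Types (v : seq nat -> seq nat -> bool) (bs A B : seq (seq nat)) (L R b : seq nat).

Definition peaked x bs j := take j bs ++ [:: x] :: drop j bs.
Definition ascended x bs j := take j bs ++ (x :: nth [::] bs j) :: drop j.+1 bs.
Definition joined x bs j :=
  take j bs ++ (nth [::] bs j ++ x :: nth [::] bs j.+1) :: drop j.+2 bs.

(** All insertions of x without double descent; v is the condition required
    from the two blocks that a valley joins. *)
Definition succ v x bs :=
  [seq peaked x bs j | j <- iota 0 (size bs).+1] ++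
  [seq ascended x bs j | j <- iota 0 (size bs)] ++
  [seq joined x bs j | j <- iota 0 (size bs).-1
                     & v (nth [::] bs j) (nth [::] bs j.+1)].

Fixpoint states v xs :=
  if xs is x :: xs' then flatten [seq succ v x bs | bs <- states v xs'] else [:: [::]].

(** The condition on lambda and rho that corresponds to v: no double descent,
    and v at the valleys. *)
Definition tree_cond v L R :=
  ((R == [::]) ==> (L == [::])) && ((R != [::]) && (L != [::]) ==> v L R).

Definition valid v xs bs :=
  perm_eq (flatten bs) xs &&
  all (fun b => (b != [::]) && locally (tree_cond v) b) bs.

Definition block b : seq (seq nat) := if b is [::] then [::] else [:: b].

Lemma split_at bs j : j < size bs -> bs = take j bs ++ nth [::] bs j :: drop j.+1 bs.
Proof. by move=> jb; rewrite -drop_nth // cat_take_drop. Qed.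

Lemma split_at2 bs j : j.+1 < size bs ->
  bs = take j bs ++ nth [::] bs j :: nth [::] bs j.+1 :: drop j.+2 bs.
Proof. by move=> jb; rewrite -!drop_nth ?cat_take_drop // ltnW. Qed.

Lemma size_peaked x bs j : (j <= size bs)%N -> size (peaked x bs j) = (size bs).+1.
Proof. by move=> jb; rewrite size_cat /= size_takel // size_drop addnS subnKC. Qed.

Lemma size_ascended x bs j : (j < size bs)%N -> size (ascended x bs j) = size bs.
Proof.
by move=> jb; rewrite size_cat /= size_takel ?(ltnW jb) // size_drop -addSnnS subnKC.
Qed.

Lemma size_joined x bs j : (j.+1 < size bs)%N -> (size (joined x bs j)).+1 = size bs.
Proof.
move=> jb; rewrite size_cat /= size_takel ?(ltnW (ltnW jb)) // size_drop.
by rewrite -addSnnS -addSn subnKC.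
Qed.

(** A common form for the three kinds of insertion, according to which of L and
    R are empty. *)
Lemma succP v x bs bs' : all (fun b => b != [::]) bs ->
  reflect (exists A L R B, [/\ bs' = A ++ (L ++ x :: R) :: B,
                               bs = A ++ block L ++ block R ++ B
                             & tree_cond v L R])
          (bs' \in succ v x bs).
Proof.
move=> ne; apply: (iffP idP).
- have nn j : j < size bs -> nth [::] bs j != [::] by move=> jb; apply: (all_nthP _ ne).
  have bl b : b != [::] -> block b = [:: b] by case: b.
  rewrite !mem_cat => /or3P[] /mapP[j]; rewrite ?mem_filter mem_iota add0n /= => jb ->.
  + exists (take j bs), [::], [::], (drop j bs); split=> //=.
    by rewrite cat_take_drop.
  + exists (take j bs), [::], (nth [::] bs j), (drop j.+1 bs); split=> //.
      by rewrite (bl (nth _ _ _)) ?nn //; exact: split_at.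
    by rewrite /tree_cond eqxx implybT andbF.
  + case/andP: jb => vj; rewrite -[_ < _]ltnS => jb.
    have {}jb : j.+1 < size bs by case: (size bs) jb.
    exists (take j bs), (nth [::] bs j), (nth [::] bs j.+1), (drop j.+2 bs); split=> //.
      by rewrite (bl (nth _ _ j)) ?(bl (nth _ _ j.+1)) ?nn ?(ltnW jb) //; exact: split_at2.
    by rewrite /tree_cond vj implybT (negbTE (nn _ _)).
- case=> A [L [R [B [-> -> cLR]]]]; rewrite !mem_cat.
  case: L cLR => [|a L]; case: R => [|c R] //.
  + move=> _; apply/or3P/Or31/mapP; exists (size A); rewrite ?mem_iota /= ?size_cat.
      by rewrite add0n ltnS leq_addr.
    by rewrite /peaked take_size_cat // drop_size_cat.
  + move=> _; apply/or3P/Or32/mapP; exists (size A); rewrite ?mem_iota /= ?size_cat.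
      by rewrite add0n -addSnnS leq_addr.
    rewrite /ascended take_size_cat // nth_cat ltnn subnn /=.
    by rewrite -[A ++ (c :: R) :: B]cat_rcons drop_size_cat ?size_rcons.
  + rewrite /tree_cond /= => vLR; apply/or3P/Or33/mapP; exists (size A).
      rewrite mem_filter !nth_cat ltnn subnn ltnNge leqnSn subSnn vLR mem_iota /=.
      by rewrite !size_cat /= !addnS /= ltnS leq_addr.
    rewrite /joined take_size_cat // !nth_cat ltnn subnn ltnNge leqnSn subSnn /=.
    have -> : A ++ [:: a :: L, c :: R & B] = rcons (rcons A (a :: L)) (c :: R) ++ B.
      by rewrite !cat_rcons.
    by rewrite drop_size_cat ?size_rcons.
Qed.

Lemma flatten_block A L R B x : perm_eq (flatten (A ++ (L ++ x :: R) :: B))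
  (x :: flatten (A ++ block L ++ block R ++ B)).
Proof.
have fb b : flatten (block b) = b by case: b => //= a b; rewrite cats0.
by apply/seq.permP => a; rewrite /= !flatten_cat /= !fb !count_cat /=; lia.
Qed.

(** The last inserted letter x is the least one; cutting its block at x
    recovers the previous list of blocks. *)
Lemma mem_states v xs bs : path ltn 0 xs -> (bs \in states v xs) = valid v xs bs.
Proof.
elim: xs bs => [|x xs IH] bs /=.
  move=> _; rewrite inE /valid; case: bs => [|[|a b] bs] //=; first by rewrite andbF.
  by apply/esym/negbTE/negP => /andP[/perm_size].
case/andP=> x0 px; have {}IH bs0 := IH bs0 (path_le ltn_trans x0 px).
have xxs : all (ltn x) xs := order_path_min ltn_trans px.
have ux : uniq (x :: xs) by apply: (sorted_uniq ltn_trans ltnn) => /=.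
have bl b : all (fun b => (b != [::]) && locally (tree_cond v) b) (block b)
   = locally (tree_cond v) b.
  by case: b => //= a b; rewrite andbT.
have key A L R B : perm_eq (flatten (A ++ block L ++ block R ++ B)) xs ->
    locally (tree_cond v) (L ++ x :: R) =
    [&& tree_cond v L R, locally (tree_cond v) L & locally (tree_cond v) R].
  move=> pf; have pf' : perm_eq (flatten (A ++ (L ++ x :: R) :: B)) (x :: xs).
    by rewrite (permPl (flatten_block _ _ _ _ _)) perm_cons.
  have fb b : flatten (block b) = b by case: b => //= a b; rewrite cats0.
  have aLR : all (ltn x) (flatten (A ++ block L ++ block R ++ B)).
    by rewrite (perm_all _ pf).
  rewrite !flatten_cat !fb !all_cat in aLR; case/and4P: aLR => _ xL xR _.
  apply: locally_cut => //; move: pf' => /perm_uniq; rewrite ux flatten_cat /=.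
  by rewrite cat_uniq => /and3P[_ _]; rewrite cat_uniq => /and3P[].
apply/flatten_mapP/idP.
- case=> bs0; rewrite IH => /andP[pf al].
  have ne : all (fun b => b != [::]) bs0 by apply: sub_all al => b /andP[].
  case/succP=> // A [L [R [B [-> E cLR]]]]; subst bs0.
  rewrite /valid (permPl (flatten_block _ _ _ _ _)) perm_cons pf /=.
  move: al; rewrite !all_cat !bl /= (key _ _ _ _ pf) cLR => /and4P[-> -> -> ->].
  by rewrite !andbT; case: (L).
- case/andP=> pf al; have : x \in flatten bs by rewrite (perm_mem pf) inE eqxx.
  case/flattenP=> b bbs xb; case/splitPr: bbs pf al => A B.
  case/splitPr: xb => L R pf al.
  have pf1 : perm_eq (flatten (A ++ block L ++ block R ++ B)) xs.
    by rewrite -(perm_cons x) -(permPl (flatten_block _ _ _ _ _)).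
  move: al; rewrite all_cat /= (key _ _ _ _ pf1) => /and3P[aA /andP[_ /and3P[cLR aL aR]] aB].
  have al : all (fun b => (b != [::]) && locally (tree_cond v) b) (A ++ block L ++ block R ++ B).
    by rewrite !all_cat aA !bl aL aR.
  exists (A ++ block L ++ block R ++ B); first by rewrite IH /valid pf1.
  apply/succP; first by apply: sub_all al => c /andP[].
  by exists A, L, R, B.
Qed.

Definition cut x b := block (take (index x b) b) ++ block (drop (index x b).+1 b).
(** Inverse of the insertion of x, used to prove that each list of blocks is
    obtained only once. *)
Definition unstep x bs := flatten [seq cut x b | b <- bs].

Lemma unstep_succ v x bs bs' : above x bs -> bs' \in succ v x bs -> unstep x bs' = bs.
Proof.
move=> xbs; have ne : all (fun b => b != [::]) bs by apply: sub_all xbs => b /andP[].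
case/(succP _ _ _ ne) => A [L [R [B [-> E _]]]].
have cutA C : above x C -> unstep x C = C.
  elim: C => //= b C IH /andP[/andP[bn xb] /IH {2}<-]; rewrite /unstep /= /cut.
  have xnb : x \notin b by apply/negP => /(allP xb) /=; rewrite ltnn.
  rewrite memNindex // take_size drop_oversize ?leqnSn //.
  by case: b bn {xb xnb}.
have ab b C : above x (block b ++ C) = all (ltn x) b && above x C by case: b.
move: xbs; rewrite E /above all_cat -!/(above _ _) !ab => /and4P[xA xL xR xB].
rewrite /unstep map_cat flatten_cat -/(unstep x A) cutA //=.
rewrite -/(unstep x B) cutA // /cut.
have xnL : x \notin L by apply/negP => /(allP xL) /=; rewrite ltnn.
rewrite index_cat (negbTE xnL) /= eqxx addn0 take_size_cat //.
by rewrite -cat_rcons drop_size_cat ?size_rcons // -catA.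
Qed.

Lemma states_above v x xs : path ltn 0 (x :: xs) -> {in states v xs, forall bs, above x bs}.
Proof.
move=> /= /andP[x0 px] bs; rewrite mem_states ?(path_le ltn_trans x0 px) // => /andP[pf al].
have : all (ltn x) (flatten bs) by rewrite (perm_all _ pf) (order_path_min ltn_trans px).
move=> aa; apply/allP => b bb; case/andP: (allP al _ bb) => -> _ /=.
by apply/allP => y yb; apply: (allP aa); apply/flattenP; exists b.
Qed.

(** The kind of an insertion is read on the number of blocks, and its rank is
    that of the block of x. *)
Lemma uniq_succ v x bs : above x bs -> uniq (succ v x bs).
Proof.
move=> xbs.
have key A b B : above x A -> x \in b ->
   find (fun b => x \in b) (A ++ b :: B) = size A.
  move=> xA xb; rewrite find_cat /= xb addn0; case: ifP => // /hasP[c cA xc].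
  by have := allP xA _ cA => /andP[_ /allP/(_ _ xc)]; rewrite /= ltnn.
have xt j : above x (take j bs) by apply/allP => b /mem_take /(allP xbs).
have sz j : j <= size bs -> size (take j bs) = j by exact: size_takel.
have s1 : {in map (peaked x bs) (iota 0 (size bs).+1), forall bs0, size bs0 = (size bs).+1}.
  by move=> b /mapP[j]; rewrite mem_iota add0n ltnS /= => jb ->; rewrite size_peaked.
have s2 : {in map (ascended x bs) (iota 0 (size bs)), forall bs0, size bs0 = size bs}.
  by move=> b /mapP[j]; rewrite mem_iota add0n /= => jb ->; rewrite size_ascended.
have s3 : {in [seq joined x bs j | j <- iota 0 (size bs).-1
          & v (nth [::] bs j) (nth [::] bs j.+1)], forall bs0, (size bs0).+1 = size bs}.
  move=> b /mapP[j]; rewrite mem_filter mem_iota add0n /= => /andP[_ jb] ->.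
  have {}jb : j.+1 < size bs by case: (size bs) jb.
  by rewrite size_joined.
rewrite /succ !cat_uniq; apply/and5P; split.
- rewrite map_inj_in_uniq ?iota_uniq // => i j; rewrite !mem_iota !add0n !ltnS /= => ib jb.
  move/(congr1 (find (fun b => x \in b))).
  by rewrite !key ?sz // inE.
- apply/hasPn => b; rewrite mem_cat => /orP[/s2|/s3] E; apply/negP => /s1; lia.
- rewrite map_inj_in_uniq ?iota_uniq // => i j; rewrite !mem_iota !add0n /= => ib jb.
  move/(congr1 (find (fun b => x \in b))).
  by rewrite !key ?sz ?inE ?eqxx // ltnW.
- apply/hasPn => b /s3 E; apply/negP => /s2; lia.
- rewrite map_inj_in_uniq ?filter_uniq ?iota_uniq // => i j.
  rewrite !mem_filter !mem_iota !add0n /= => /andP[_ ib] /andP[_ jb].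
  move/(congr1 (find (fun b => x \in b))).
  by rewrite !key ?sz ?mem_cat ?inE ?eqxx ?orbT //; lia.
Qed.

Lemma uniq_states v xs : path ltn 0 xs -> uniq (states v xs).
Proof.
elim: xs => //= x xs IH xxs; have := @states_above v _ _ xxs.
case/andP: xxs => x0 px; move: (IH (path_le ltn_trans x0 px)) => {IH}.
elim: (states v xs) => //= bs S IH /andP[bsS uS] xS.
have xbs : above x bs by apply: xS; rewrite mem_head.
have {}xS : {in S, forall bs, above x bs} by move=> b bS; apply: xS; rewrite inE bS orbT.
change (uniq (succ v x bs ++ flatten [seq succ v x c | c <- S])).
rewrite cat_uniq uniq_succ // IH // andbT; apply/hasPn => bs' /flatten_mapP[bs1 b1S H].
apply: contra bsS => H'.
by rewrite -(unstep_succ xbs H') (unstep_succ (xS _ b1S) H).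
Qed.

End States.

(** * The weighted sums over block lists *)

Section Transfer.
Variables (K : fieldType) (h p q : K).
Hypothesis h0 : h != 0.

Definition weight (bs : seq (seq nat)) : K :=
  h ^+ drops (padded bs) * p ^+ occ31_2 (padded bs) * q ^+ occ2_13 (padded bs).

(** The function g will select the number of descents of the padded word,
    which for one block is one more than the number of valleys.  An arbitrary g
    absorbs both the shift caused by a new peak and the powers of r. *)
Definition total v xs (Q : pred (seq (seq nat))) (g : nat -> K) : K :=
  \sum_(bs <- states v xs | Q bs) weight bs * g (descents (padded bs)).

Lemma above_split x bs j : above x bs -> above x (take j bs) /\ above x (drop j bs).
Proof. by rewrite -{1}(cat_take_drop j bs) /above all_cat => /andP. Qed.

Lemma above_nth x bs j : above x bs -> (j < size bs)%N ->
  nth [::] bs j != [::] /\ all (ltn x) (nth [::] bs j).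
Proof. by move=> xbs jb; apply/andP; apply: (all_nthP [::] xbs). Qed.

Lemma weight_peaked x bs j g : (0 < x)%N -> above x bs -> (j <= size bs)%N ->
  weight (peaked x bs j) * g (descents (padded (peaked x bs j))) =
  p ^+ j * q ^+ (size bs - j) * (weight bs * (h ^+ x * g (descents (padded bs)).+1)).
Proof.
move=> x0 xbs jb; have [xA xB] := above_split j xbs.
have [e1 e2 e3 e4] := stats_peak x (take j bs) (drop j bs) x0 xA xB.
rewrite /weight /peaked e1 e2 e3 e4 cat_take_drop size_takel // size_drop !exprD.
ring.
Qed.

Lemma weight_ascended x bs j g : (0 < x)%N -> above x bs -> (j < size bs)%N ->
  weight (ascended x bs j) * g (descents (padded (ascended x bs j))) =
  p ^+ j * q ^+ (size bs - j.+1) * (weight bs * g (descents (padded bs))).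
Proof.
move=> x0 xbs jb; have [xA _] := above_split j xbs; have [_ xB] := above_split j.+1 xbs.
have [Rn xR] := above_nth xbs jb.
have [e1 e2 e3 e4] := stats_ascent x _ _ x0 xA xB _ Rn xR.
rewrite /weight /ascended e1 e2 e3 e4 -split_at // size_takel ?(ltnW jb) // size_drop !exprD.
ring.
Qed.

Lemma weight_joined x bs j g : (0 < x)%N -> above x bs -> (j.+1 < size bs)%N ->
  weight (joined x bs j) * g (descents (padded (joined x bs j))) =
  p ^+ j * q ^+ (size bs - j.+2) * (weight bs * (h ^- x * g (descents (padded bs)))).
Proof.
move=> x0 xbs jb; have [xA _] := above_split j xbs; have [_ xB] := above_split j.+2 xbs.
have [Ln xL] := above_nth xbs (ltnW jb); have [Rn xR] := above_nth xbs jb.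
have [e1 e2 e3 e4] := stats_valley x _ _ x0 xA xB _ _ Ln xL Rn xR.
rewrite -split_at2 // in e1 e2 e3 e4.
rewrite /weight /joined e1 e2 e3 -e4.
rewrite size_takel ?(ltnW (ltnW jb)) // size_drop !exprD.
have hx : h ^+ x != 0 by rewrite expf_neq0.
by field.
Qed.

Lemma big_iota m (P : pred nat) (F : nat -> K) :
  \sum_(j <- iota 0 m | P j) F j = \sum_(j < m | P j) F j.
Proof. by rewrite -(big_mkord P F) /index_iota subn0. Qed.

(** Fixing the number m of blocks after the insertion makes the factor
    p^j q^(m-1-j) common to the three kinds. *)
Lemma sum_succ v x bs m (Q : pred (seq (seq nat))) g : (0 < x)%N -> above x bs ->
  (forall bs', Q bs' -> size bs' = m) ->
  \sum_(bs' <- succ v x bs | Q bs') weight bs' * g (descents (padded bs')) =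
  \sum_(j < m) p ^+ j * q ^+ (m - j.+1) * (
    (if ((size bs).+1 == m) && Q (peaked x bs j)
      then weight bs * (h ^+ x * g (descents (padded bs)).+1) else 0)
    + (if (size bs == m) && Q (ascended x bs j)
      then weight bs * g (descents (padded bs)) else 0)
    + (if [&& size bs == m.+1, v (nth [::] bs j) (nth [::] bs j.+1) & Q (joined x bs j)]
      then weight bs * (h ^- x * g (descents (padded bs))) else 0)).
Proof.
move=> x0 xbs Qm; under [RHS]eq_bigr => j _ do rewrite !mulrDr.
rewrite [RHS]big_split [X in _ = X + _]big_split.
rewrite /succ 2!big_cat [LHS]addrA; congr (_ + _ + _); rewrite big_map.
- case: eqP => [<-|nm]; last first.
    rewrite big1_seq => [|j /andP[/Qm]]; first by rewrite big1 // => j _ /=; rewrite mulr0.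
    rewrite mem_iota add0n /= => /[swap] jb.
    by rewrite size_peaked // => /nm.
  rewrite big_iota big_mkcond.
  apply: eq_bigr => j _ /=; case: ifP => _; last by rewrite mulr0.
  by rewrite weight_peaked // -ltnS.
- case: eqP => [<-|nm]; last first.
    rewrite big1_seq => [|j /andP[/Qm]]; first by rewrite big1 // => j _ /=; rewrite mulr0.
    rewrite mem_iota add0n /= => /[swap] jb.
    by rewrite size_ascended // => /nm.
  rewrite big_iota big_mkcond.
  apply: eq_bigr => j _ /=; case: ifP => _; last by rewrite mulr0.
  by rewrite weight_ascended.
- case: eqP => [sm|nm]; last first.
    rewrite big1_seq => [|j /andP[/Qm]]; first by rewrite big1 // => j _ /=; rewrite mulr0.
    rewrite mem_filter mem_iota add0n /= => /[swap] /andP[_ jb].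
    have {}jb : (j.+1 < size bs)%N by case: (size bs) jb.
    by move=> sm; case: nm; rewrite -sm size_joined.
  rewrite big_filter_cond big_iota sm big_mkcond.
  apply: eq_bigr => j _ /=; case: ifP => _; last by rewrite mulr0.
  by rewrite weight_joined ?sm ?ltnS.
Qed.

Lemma total_step v x xs m (Q : pred (seq (seq nat))) g : path ltn 0 (x :: xs) ->
  (forall bs, Q bs -> size bs = m) ->
  total v (x :: xs) Q g =
  \sum_(j < m) p ^+ j * q ^+ (m - j.+1) * (
    h ^+ x * total v xs (fun bs => ((size bs).+1 == m) && Q (peaked x bs j)) (g \o succn)
    + total v xs (fun bs => (size bs == m) && Q (ascended x bs j)) g
    + h ^- x * total v xs (fun bs => [&& size bs == m.+1,
          v (nth [::] bs j) (nth [::] bs j.+1) & Q (joined x bs j)]) g).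
Proof.
move=> px Qm; have x0 : (0 < x)%N by case/andP: px.
rewrite /total /= big_flatten big_map big_seq.
under eq_bigr => bs bsS do rewrite (sum_succ v _ x0 (states_above px bsS) Qm).
rewrite -big_seq exchange_big /=; apply: eq_bigr => j _.
rewrite -mulr_sumr !big_split /=; congr (_ * (_ + _ + _)).
- rewrite mulr_sumr [RHS]big_mkcond; apply: eq_bigr => bs _.
  by case: ifP => // _; rewrite mulrCA.
- by rewrite [RHS]big_mkcond.
- rewrite mulr_sumr [RHS]big_mkcond; apply: eq_bigr => bs _.
  by case: ifP => // _; rewrite mulrCA.
Qed.

Definition always (L R : seq nat) := true.
Definition min_right (L R : seq nat) := (min_letter R < min_letter L)%N.

Lemma eq_total v x xs Q Q' g : path ltn 0 (x :: xs) ->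
  (forall bs, above x bs -> Q bs = Q' bs) -> total v xs Q g = total v xs Q' g.
Proof.
move=> px QQ; rewrite /total big_seq_cond [RHS]big_seq_cond; apply: eq_bigl => bs.
by case E: (bs \in _) => //=; apply: QQ; apply: states_above px _ E.
Qed.

(** The three kinds of insertion, summed over the previous block lists; this
    does not depend on the rank of the new block. *)
Definition moves x xs m g :=
  h ^+ x * total always xs (fun bs => (size bs).+1 == m) (g \o succn)
  + total always xs (fun bs => size bs == m) g
  + h ^- x * total always xs (fun bs => size bs == m.+1) g.

Lemma total_always_step x xs m g : path ltn 0 (x :: xs) ->
  total always (x :: xs) (fun bs => size bs == m) g =
  (\sum_(j < m) p ^+ j * q ^+ (m - j.+1)) * moves x xs m g.
Proof.
move=> px; rewrite (@total_step _ _ _ m) => //; last by move=> bs /eqP.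
rewrite mulr_suml; apply: eq_bigr => j _; congr (_ * (_ * _ + _ + _ * _));
  apply: (eq_total _ _ px) => bs _.
- case: eqP => //= E; rewrite size_peaked ?E ?eqxx //.
  by rewrite -ltnS E ltn_ord.
- by case: eqP => //= E; rewrite size_ascended ?E ?eqxx.
- by case: eqP => //= E; rewrite -eqSS size_joined E ?ltnS ?eqxx.
Qed.

(** After the removal of x, the pattern loses its part at x, keeps it, or
    receives a pair in its place; in the last case the condition on the pair is
    the Andre condition that allows the join. *)
Lemma total_min_right_step x xs e g : path ltn 0 (x :: xs) ->
  total min_right (x :: xs) (matches e) g =
  \sum_(j < width e) p ^+ j * q ^+ (width e - j.+1) *
    (if unmin e j is Some (e1, e2) then
       h ^+ x * total min_right xs (matches (e1 ++ e2)) (g \o succn)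
       + total min_right xs (matches (e1 ++ false :: e2)) g
       + h ^- x * total min_right xs (matches (e1 ++ true :: e2)) g
     else 0).
Proof.
move=> px; rewrite (@total_step _ _ _ (width e)) => //; last exact: matches_size.
apply: eq_bigr => j _; congr (_ * _).
have tot0 (Q : pred _) f : (forall bs, above x bs -> Q bs = false) ->
    total min_right xs Q f = 0.
  by move=> Q0; rewrite (eq_total _ _ px Q0) /total big_pred0_eq.
have P1 bs : above x bs -> (size bs).+1 == width e -> matches e (peaked x bs j) =
    if unmin e j is Some (e1, e2) then matches (e1 ++ e2) bs else false.
  move=> xbs /eqP sz; have [xA xB] := above_split j xbs.
  have jb : (j <= size bs)%N by rewrite -ltnS sz ltn_ord.
  have m1 : min_letter [:: x] = x := @min_letter_root x [::] [::] isT isT.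
  rewrite /peaked (@matches_remin x _ _ _ _ [::] [::]) // size_takel //=.
  by case: (unmin e j) => [[e1 e2]|] //; rewrite cat_take_drop.
have P2 bs : above x bs -> size bs == width e -> matches e (ascended x bs j) =
    if unmin e j is Some (e1, e2) then matches (e1 ++ false :: e2) bs else false.
  move=> xbs /eqP sz; have [xA _] := above_split j xbs; have [_ xB] := above_split j.+1 xbs.
  have jb : (j < size bs)%N by rewrite sz ltn_ord.
  have [Rn xR] := above_nth xbs jb.
  rewrite /ascended (@matches_remin x _ _ _ _ [:: false] [:: nth [::] bs j]) //.
    by rewrite size_takel ?(ltnW jb) //; case: (unmin e j) => [[e1 e2]|] //; rewrite -split_at.
  exact: (@min_letter_root x [::]).
have P3 bs : above x bs -> size bs == (width e).+1 ->
    min_right (nth [::] bs j) (nth [::] bs j.+1) && matches e (joined x bs j) =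
    if unmin e j is Some (e1, e2) then matches (e1 ++ true :: e2) bs else false.
  move=> xbs /eqP sz; have [xA _] := above_split j xbs; have [_ xB] := above_split j.+2 xbs.
  have jb : (j.+1 < size bs)%N by rewrite sz ltnS ltn_ord.
  have [Ln xL] := above_nth xbs (ltnW jb); have [Rn xR] := above_nth xbs jb.
  have st : size (take j bs) = j by rewrite size_takel // ltnW // ltnW.
  case vj: (min_right _ _) => /=.
    rewrite /joined (@matches_remin x _ _ _ _ [:: true]
      [:: nth [::] bs j; nth [::] bs j.+1]) ?st ?min_letter_root //=.
      by case: (unmin e j) => [[e1 e2]|] //; rewrite -split_at2.
    by rewrite -/(min_right _ _) vj.
  case E: (unmin e j) => [[e1 e2]|] //; have [w1 _] := unmin_width E.
  rewrite (congr1 (matches _) (split_at2 jb)) matches_cat ?st ?w1 //=.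
  by rewrite -/(min_right _ _) vj andbF.
case E: (unmin e j) => [[e1 e2]|]; rewrite E in P1 P2 P3.
- have [w1 w2] := unmin_width E.
  congr (_ * _ + _ + _ * _); apply: (eq_total _ _ px) => bs xbs.
  + case sz: (_ == _) => /=; first by rewrite P1.
    apply/esym/negbTE/negP => /matches_size sz'; move/eqP: sz; apply.
    by move: sz' w2; rewrite width_cat w1 /=; lia.
  + case sz: (_ == _) => /=; first by rewrite P2.
    apply/esym/negbTE/negP => /matches_size sz'; move/eqP: sz; apply.
    by move: sz' w2; rewrite width_cat w1 /=; lia.
  + case sz: (_ == _) => /=; first by rewrite P3.
    apply/esym/negbTE/negP => /matches_size sz'; move/eqP: sz; apply.
    by move: sz' w2; rewrite width_cat w1 /=; lia.
- rewrite !tot0 ?mulr0 ?addr0 // => bs xbs.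
  + by case sz: (_ == _) => //=; rewrite P3.
  + by case sz: (_ == _) => //=; rewrite P2.
  + by case sz: (_ == _) => //=; rewrite P1.
Qed.

Section Ratio.
Variable r : K.
Hypotheses (r_def : r * (p + q) = p) (r0 : r != 0).

Lemma total_scale v xs Q c g : total v xs Q (fun d => c * g d) = c * total v xs Q g.
Proof. by rewrite /total mulr_sumr; apply: eq_bigr => bs _; rewrite mulrCA. Qed.

Lemma eq_total_r v xs Q g g' : g =1 g' -> total v xs Q g = total v xs Q g'.
Proof. by move=> gg; apply: eq_bigr => bs _; rewrite gg. Qed.

(** The invariant.  The number of valleys is the number d of descents of the
    padded word minus the number of blocks, so the Andre condition should
    contribute r^(d - width e); the factor r^(width e) on the left avoids
    subtraction. *)
Lemma total_matches xs e g : path ltn 0 xs ->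
  total min_right xs (matches e) g * r ^+ width e =
  r ^+ count id e * total always xs (fun bs => size bs == width e) (fun d => g d * r ^+ d).
Proof.
elim: xs e g => [|x xs IH] e g px.
  rewrite /total !big_cons !big_nil !addr0.
  have d0 : descents (padded [::]) = 0%N by [].
  by case: e => [|[] e] /=; rewrite ?mul0r ?mulr0 // d0 !mulr1 mul1r.
have pxs : path ltn 0 xs by case/andP: px => x0 /(path_le ltn_trans x0).
rewrite total_min_right_step // total_always_step // mulrA -(unmin_sum r_def).
rewrite !mulr_suml; apply: eq_bigr => j _.
case E: (unmin e j) => [[e1 e2]|]; last by rewrite mulr0 !mul0r.
have [w1 w2] := unmin_width E.
rewrite -!mulrA; congr (_ * (_ * _)); rewrite /moves.
have I1 := IH (e1 ++ e2) (g \o succn) pxs.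
have I2 := IH (e1 ++ false :: e2) g pxs.
have I3 := IH (e1 ++ true :: e2) g pxs.
have W1 : (width (e1 ++ e2)).+1 = width e by move: w2; rewrite width_cat w1; lia.
have W2 : width (e1 ++ false :: e2) = width e by move: w2; rewrite width_cat w1 /=; lia.
have W3 : width (e1 ++ true :: e2) = (width e).+1 by move: w2; rewrite width_cat w1 /=; lia.
have -> : total always xs (fun bs => (size bs).+1 == width e) ((fun d => g d * r ^+ d) \o succn)
   = r * total always xs (fun bs => size bs == width (e1 ++ e2)) (fun d => (g \o succn) d * r ^+ d).
  rewrite -total_scale -W1; apply: eq_total_r => d /=.
  by rewrite exprS mulrCA.
rewrite W2 !count_cat /= add0n in I2; rewrite W3 !count_cat /= in I3.
rewrite !count_cat in I1; rewrite mulrDl mulrDl !mulrDr I2; congr (_ + _ + _).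
  by rewrite -W1 exprS -mulrA [_ * (r * _)]mulrCA I1; ring.
(* The pair created by the join costs a factor r, which the larger width
   gives back. *)
apply: (mulfI r0); rewrite addnS exprS in I3.
transitivity (h ^- x * (total min_right xs (matches (e1 ++ true :: e2)) g *
  (r * r ^+ width e))); first by ring.
by rewrite I3 exprS; ring.
Qed.

End Ratio.
End Transfer.

(** * Statistics of a permutation read on its padded word *)

Section Statistics.
Local Open Scope nat_scope.

Lemma pairsum_nth f z :
  pairsum f z = \sum_(0 <= i < (size z).-1) f (nth 0 z i) (nth 0 z i.+1).
Proof.
elim: z => [|a [|b z] IH]; [by rewrite big_geq | by rewrite big_geq |].
by rewrite -[LHS]/(f a b + pairsum f (b :: z)) IH [RHS]big_nat_recl.
Qed.

Lemma pairsum_rev f z : pairsum f (rev z) = pairsum (fun a b => f b a) z.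
Proof.
elim: z => [|a [|b z] IH] //.
rewrite !rev_cons -cats1 cat_rcons pairsum_cat -rev_cons IH /=.
by rewrite !addn0 addnC.
Qed.

Lemma occ2_13_nth z : occ2_13 z =
  \sum_(0 <= i < size z) \sum_(i.+1 <= j < (size z).-1)
     ((nth 0 z j < nth 0 z i) && (nth 0 z i < nth 0 z j.+1)).
Proof.
elim: z => [|y z IH] /=; first by rewrite big_geq.
rewrite big_nat_recl // {}IH /straddle pairsum_nth big_add1; congr (_ + _).
by apply: eq_bigr => i _; rewrite [RHS]big_add1.
Qed.

Lemma occ31_2_nth z : occ31_2 z =
  \sum_(0 <= i < size z) \sum_(i.+1 <= j < size z)
     ((nth 0 z i > nth 0 z j) && (nth 0 z j > nth 0 z i.+1)).
Proof.
rewrite /occ31_2; elim/last_ind: z => [|z y IH]; first by rewrite big_geq.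
rewrite rev_rcons /= {}IH size_rcons [RHS]big_nat_recr //= [X in _ = _ + X]big_geq // addn0.
rewrite /straddle pairsum_rev pairsum_nth addnC.
have -> : \sum_(0 <= i < (size z).-1) ((nth 0 z i.+1 < y) && (y < nth 0 z i)) =
  \sum_(0 <= i < size z) ((y < nth 0 z i) && (nth 0 (rcons z y) i.+1 < y)).
  case sz: (size z) => [|n]; first by rewrite !big_geq.
  rewrite [RHS]big_nat_recr //= !nth_rcons sz ltnn eqxx ltnn andbF addn0.
  by apply: eq_big_nat => i /= ib; rewrite nth_rcons sz ltnS ib andbC.
rewrite -big_split; apply: eq_big_nat => i /= ib.
rewrite [RHS]big_nat_recr //= !nth_rcons ltnn eqxx ib; congr (_ + _).
by apply: eq_big_nat => j /andP[ij jb]; rewrite !nth_rcons jb (leq_ltn_trans ij jb).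
Qed.

Section Perm.
Arguments letter : simpl never.
Variable w : seq nat.
Hypothesis wP : perm_eq w (iota 1 (size w)).
Hypothesis w0 : 0 < size w.

Lemma letter_padded i : nth 0 (padded [:: w]) i = letter w i.
Proof.
rewrite padded_cons /letter; case: i => //= i.
rewrite nth_cat; case: ltnP => // wi; rewrite [RHS]nth_default //.
by case: (i - _) => // -[].
Qed.

Lemma size_padded1 : size (padded [:: w]) = (size w).+2.
Proof. by rewrite padded_cons /= size_cat addn1. Qed.

Lemma pairsum_letter f :
  pairsum f (padded [:: w]) = \sum_(0 <= i < (size w).+1) f (letter w i) (letter w i.+1).
Proof. by rewrite pairsum_nth size_padded1; apply: eq_bigr => i _; rewrite !letter_padded. Qed.

Lemma letter_bounds i : 0 < i <= size w -> 0 < letter w i <= size w.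
Proof.
case: i => //= i iw; have : nth 0 w i \in iota 1 (size w).
  by rewrite -(perm_mem wP) mem_nth.
by rewrite mem_iota add1n ltnS.
Qed.

Lemma letter_out : letter w (size w).+1 = 0.
Proof. by rewrite /letter nth_default. Qed.

Lemma uniq_word : uniq w.
Proof. by rewrite (perm_uniq wP) iota_uniq. Qed.

Lemma letter_inj : {in [pred i | 0 < i <= size w] &, injective (letter w)}.
Proof.
move=> [|i] [|j] //; rewrite !inE /= => ib jb /eqP.
by rewrite /letter /= nth_uniq ?uniq_word // => /eqP ->.
Qed.

Lemma letter_neq i : i <= size w -> letter w i != letter w i.+1.
Proof.
case: i => [_|i iw].
  have := @letter_bounds 1; rewrite w0 => /(_ isT) /andP[l1 _].
  by rewrite neq_ltn l1.
have [E|nE] := eqVneq i.+1 (size w).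
  rewrite E letter_out; have := @letter_bounds i.+1; rewrite iw => /(_ isT).
  by rewrite -E neq_ltn => /andP[-> _]; rewrite orbT.
apply/eqP => /letter_inj; rewrite !inE /= iw ltn_neqAle nE iw => /(_ isT isT); lia.
Qed.

Lemma descents_des : descents (padded [:: w]) = (des w).+1.
Proof.
rewrite /descents pairsum_letter big_nat_recr // letter_out big_ltn // ltn0 [LHS]/=.
have := @letter_bounds (size w); rewrite w0 leqnn => /(_ isT) /andP[-> _].
rewrite add0n addn1 /des; congr _.+1; rewrite [RHS]big_mkcond; apply: eq_bigr => i _.
by case: ifP.
Qed.

Lemma occ2_13_vin : occ2_13 (padded [:: w]) = vin2_13 w.
Proof.
rewrite occ2_13_nth size_padded1 succnK.
under eq_bigr => i _ do under eq_bigr => j _ do rewrite !letter_padded.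
rewrite big_nat_recr //= [X in _ + X]big_geq // addn0.
rewrite big_nat_recr //= [X in _ + X]big_geq // addn0.
rewrite big_ltn // [X in X + _]big1 ?add0n => [|j _]; last by rewrite ltn0.
apply: eq_big_nat => i /andP[_ iw]; rewrite big_nat_recr //= letter_out ltn0.
rewrite andbF [LHS]addn0 [RHS]big_mkcond; apply: eq_bigr => j _.
by case: ifP.
Qed.

Lemma occ31_2_vin : occ31_2 (padded [:: w]) = vin31_2 w.
Proof.
rewrite occ31_2_nth size_padded1.
under eq_bigr => i _ do under eq_bigr => j _ do rewrite !letter_padded.
rewrite big_nat_recr //= [X in _ + X]big_geq // addn0.
rewrite big_ltn // [X in X + _]big1 ?add0n => [|j _]; last by rewrite ltn0.
apply: eq_big_nat => i /andP[_ iw]; rewrite big_nat_recr //= letter_out ltn0.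
rewrite andbF [LHS]addn0 [RHS]big_mkcond; apply: eq_bigr => j _.
by case: ifP.
Qed.

Lemma mem_Pk_size : size w \in Pk w.
Proof.
have Nw : size w \in w by rewrite (perm_mem wP) mem_iota add1n ltnS w0 leqnn.
have iw : index (size w) w < size w by rewrite index_mem.
apply/mapP; exists (index (size w) w).+1; last by rewrite /letter /= nth_index.
rewrite mem_filter mem_index_iota !ltnS iw andbT /peak /=.
have lN : letter w (index (size w) w).+1 = size w by rewrite /letter /= nth_index.
have le i : letter w i <= size w.
  case: (posnP i) => [->//|i0]; case: (leqP i (size w)) => ib.
    by have /andP[] := @letter_bounds i (introT andP (conj i0 ib)).
  by rewrite /letter nth_default.
have := letter_neq (ltnW iw); have := letter_neq iw; rewrite lN => n1 n2.
by rewrite !ltn_neqAle !le n2 eq_sym n1.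
Qed.

Lemma uniq_Pk : uniq (Pk w).
Proof.
rewrite map_inj_in_uniq ?filter_uniq ?iota_uniq // => i j.
rewrite !mem_filter !mem_index_iota !ltnS => /andP[_ ib] /andP[_ jb].
exact: letter_inj.
Qed.

(** In the sum of a - b over descents ab a peak occurs once positively, a valley
    once negatively, a double ascent not at all and a double descent twice with
    opposite signs.  The largest letter is a peak that D leaves out. *)
Lemma drops_D : ((drops (padded [:: w]))%:Z = D w + (size w)%:Z)%R.
Proof.
have -> : (D w + (size w)%:Z = \sum_(x <- Pk w) x%:Z - \sum_(x <- Val w) x%:Z)%R.
  by rewrite (bigD1_seq _ mem_Pk_size uniq_Pk) /= /D; ring.
rewrite /Pk /Val !big_map !big_filter [X in (X - _)%R]big_mkcond [X in (_ - X)%R]big_mkcond /=.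
rewrite -sumrB /drops pairsum_letter.
pose A i := (if (letter w i.+1 < letter w i)%N then (letter w i)%:Z else 0)%R.
pose B i := (if (letter w i.+1 < letter w i)%N then (letter w i.+1)%:Z else 0)%R.
transitivity (\sum_(0 <= i < (size w).+1) (A i - B i))%R.
  rewrite (big_morph _ PoszD (erefl : 0%:Z = 0%R)); apply: eq_bigr => i _.
  rewrite /A /B; case: ltnP => ll; first by rewrite subzn // ltnW.
  by rewrite subr0; congr Posz; apply/eqP; rewrite subn_eq0.
transitivity (\sum_(1 <= i < (size w).+1) (A i - B i.-1))%R.
  rewrite !sumrB big_ltn // [A 0]/A ltn0 add0r; congr (_ - _)%R.
  by rewrite big_nat_recr //= [in RHS]big_add1 /= /B letter_out if_same addr0.
apply: eq_big_nat => -[|i] // /andP[_]; rewrite ltnS => ib; rewrite /A /B /peak /valley /=.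
have := letter_neq (ltnW ib); have := letter_neq ib.
by case: ltngtP => // _ _; case: ltngtP => // _ _; rewrite /= ?subr0 ?sub0r ?subrr.
Qed.

Lemma head_le_drops a A : a <= drops (a :: rcons A 0).
Proof.
rewrite /drops; elim: A a => [|b A IH] a; first by rewrite /= !addn0 subn0.
rewrite rcons_cons -[pairsum _ _]/(a - b + pairsum subn (b :: rcons A 0)).
by have := IH b; lia.
Qed.

Lemma size_le_drops : size w <= drops (padded [:: w]).
Proof.
have : size w \in w by rewrite (perm_mem wP) mem_iota add1n ltnS w0 leqnn.
move: (size w) => m; case/splitPr => L R.
rewrite padded_cons -catA -cat_cons [(m :: R) ++ _]cat_cons cats1 /drops pairsum_cat.
by apply: leq_trans (leq_addl _ _); apply: head_le_drops.
Qed.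

Lemma lambda_nil i : i < size w ->
  (lambda w (nth 0 w i) == [::]) = (letter w i <= nth 0 w i).
Proof.
move=> iw; rewrite /lambda index_uniq ?uniq_word //.
rewrite -size_eq0 size_rev size_eq0 prefix_gt_nil; congr (_ <= _).
case: i iw => [|i] iw; first by rewrite take0.
by rewrite (take_nth 0) ?(ltnW iw) // rev_rcons.
Qed.

Lemma rho_nil i : i < size w ->
  (rho w (nth 0 w i) == [::]) = (nth 0 w i.+1 <= nth 0 w i).
Proof.
move=> iw; rewrite /rho index_uniq ?uniq_word // prefix_gt_nil; congr (_ <= _).
by rewrite -nth0 nth_drop addn0.
Qed.

Lemma dd_locally : (dd w == 0) = locally (tree_cond always) w.
Proof.
rewrite /dd sum1_count -leqn0 leqNgt -has_count -all_predC.
have E i : i < size w -> ~~ ddescent w i.+1 =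
    tree_cond always (lambda w (nth 0 w i)) (rho w (nth 0 w i)).
  move=> iw; rewrite /tree_cond /always implybT andbT lambda_nil // rho_nil //.
  have := letter_neq (ltnW iw); have := letter_neq iw; rewrite /ddescent /letter /=.
  move: (nth 0 (0 :: w) i) (nth 0 w i) (nth 0 w i.+1) => a b c; lia.
apply/allP/(all_nthP 0) => H i.
  by move=> iw; rewrite -E //; apply: (H i.+1); rewrite mem_index_iota !ltnS.
rewrite mem_index_iota; case: i => // i /andP[_ iw] /=.
by rewrite E //; apply: H.
Qed.

Lemma andre2_locally : andre2 w = locally (tree_cond min_right) w.
Proof.
rewrite /andre2 dd_locally; apply: andb_idl => /allP H; apply/allP => x xw.
by have /andP[H1 _] := H x xw; rewrite /tree_cond /always implybT andbT.
Qed.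

Lemma min_letter_mem b : b != [::] -> min_letter b \in b.
Proof.
case: b => // a b _; rewrite /min_letter [head _ _]/=.
have : a \in a :: b by rewrite mem_head.
move: {1 3}a => d; move: (a :: b) => s.
have : foldr minn d s \in d :: s.
  elim: s => [|c s IH] /=; first by rewrite mem_head.
  rewrite /minn; case: ifP => _; first by rewrite !inE eqxx orbT.
  by move: IH; rewrite !inE => /orP[->|->] //; rewrite !orbT.
by rewrite inE => /orP[/eqP->|].
Qed.

Lemma prefix_gt_above x s : all (ltn x) (prefix_gt x s).
Proof.
rewrite /prefix_gt; elim: s => //= a s IH; case: leqP => //= xa.
by rewrite xa.
Qed.

(** At a descent ab, the factor lambda of b contains a, so rho is not empty and
    its minimum is a letter on the right strictly between b and a. *)
Lemma des_le_vin31 : andre2 w -> des w <= vin31_2 w.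
Proof.
rewrite andre2_locally => /(all_nthP 0) H.
rewrite /vin31_2 big_nat_recr //= -[des w]addn0 leq_add // /des big_mkcond.
rewrite big_nat_cond [leqRHS]big_nat_cond leq_sum // => -[|i] /andP[/= ib _] //.
case: ifP => // desc; rewrite sum1_count -has_count.
have iw := H _ ib; set x := nth 0 w i.+1 in iw.
have ln : lambda w x != [::] by rewrite lambda_nil // -ltnNge.
case/andP: iw => c1 c2; rewrite ln andbT in c2.
have rn : rho w x != [::] by apply: contraNN ln; apply/implyP.
rewrite rn /= in c2.
have al : letter w i.+1 \in lambda w x.
  rewrite /lambda index_uniq ?uniq_word // mem_rev (take_nth 0) ?(ltnW ib) //.
  by rewrite rev_rcons /prefix_gt /= leqNgt desc mem_head.
have lt : min_letter (rho w x) < letter w i.+1.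
  by apply: leq_trans c2 _; apply: foldr_minn_le.
have gt : x < min_letter (rho w x) by apply: min_letter_gt => //; apply: prefix_gt_above.
have : min_letter (rho w x) \in drop i.+2 w.
  have := min_letter_mem rn; move: (min_letter _) => y.
  by rewrite /rho index_uniq ?uniq_word // => /mem_take.
case/(nthP 0) => k; rewrite size_drop nth_drop ltn_subRL => kb kE.
(* The positions of [letter] start at 1, those of [nth] at 0. *)
apply/hasP; exists (i.+2 + k).+1.
  have ij : i.+1 < (i.+2 + k).+1 by lia.
  by rewrite mem_index_iota ij andTb ltnS.
have -> : letter w (i.+2 + k).+1 = min_letter (rho w x) := kE.
by rewrite lt.
Qed.

End Perm.
End Statistics.

(** * From block lists to permutations *)

Section PermSums.

Lemma size_word N (s : 'S_N) : size (word s) = N.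
Proof. by rewrite size_map size_enum_ord. Qed.

Lemma word_inj N : injective (@word N).
Proof.
move=> s t /eq_in_map E; apply/permP => i; apply/val_inj/succn_inj.
by apply: E; rewrite mem_enum.
Qed.

Lemma word_perm N (s : 'S_N) : perm_eq (word s) (iota 1 N).
Proof.
have -> : word s = [seq i.+1 | i <- [seq val (s i) | i <- enum 'I_N]] by rewrite -map_comp.
rewrite -[1%N]addn0 iotaDl; apply: perm_map.
rewrite -val_enum_ord (map_comp val s); apply: perm_map.
apply: uniq_perm; rewrite ?enum_uniq ?(map_inj_uniq perm_inj) ?enum_uniq // => i.
rewrite mem_enum inE -[i](permKV s) mem_map ?mem_enum //; exact: perm_inj.
Qed.

Lemma word_surj N w : perm_eq w (iota 1 N) -> exists s : 'S_N, word s = w.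
Proof.
move=> wP; have us : uniq [seq word s | s <- enum 'S_N].
  by rewrite (map_inj_uniq (@word_inj N)) enum_uniq.
have sub : {subset [seq word s | s <- enum 'S_N] <= permutations (iota 1 N)}.
  by move=> _ /mapP[s _ ->]; rewrite mem_permutations word_perm.
have [|_ E] := uniq_min_size us sub.
  rewrite size_permutations ?iota_uniq // size_iota size_map.
  by rewrite -cardE card_Sn.
have : w \in permutations (iota 1 N) by rewrite mem_permutations.
by rewrite -E => /mapP[s _ ->]; exists s.
Qed.

(** Single blocks on the letters 1, ..., N are words of permutations. *)
Lemma sum_states (K : nmodType) v N (F : seq nat -> K) : (0 < N)%N ->
  \sum_(s : 'S_N | locally (tree_cond v) (word s)) F (word s) =
  \sum_(bs <- states v (iota 1 N) | size bs == 1%N) F (head [::] bs).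
Proof.
move=> N0; have pN : path ltn 0 (iota 1 N) by exact: (iota_ltn_sorted 0 N.+1).
rewrite -[LHS]big_filter -[RHS]big_filter.
rewrite -(big_map (@word N) xpredT F) -(big_map (head [::]) xpredT F).
apply: perm_big; apply: uniq_perm.
- by rewrite (map_inj_uniq (@word_inj N)) filter_uniq ?index_enum_uniq.
- rewrite map_inj_in_uniq ?filter_uniq ?uniq_states // => A B.
  rewrite !mem_filter => /andP[sA _] /andP[sB _].
  by case: A B sA sB => [|a []] // [|b []] //= _ _ ->.
- move=> w; apply/mapP/mapP => [[s]|[bs]]; rewrite mem_filter => /andP[Hs Hin] ->.
    exists [:: word s] => //; rewrite mem_filter mem_states // /valid /= cats0 word_perm.
    by rewrite Hs -size_eq0 size_word -lt0n N0.
  case: bs Hs Hin => [|b []] // _; rewrite mem_states // /valid /= cats0 andbT.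
  case/and3P=> /word_surj[s <-] _ ls; exists s => //.
  by rewrite mem_filter ls mem_index_enum.
Qed.

End PermSums.

Lemma variable_neq0 (i : 'I_3) : tofrac ('X_i : ZPoly) != 0 :> ZFrac.
Proof.
rewrite tofrac_eq0; apply/eqP => /(congr1 (mcoeff U_(i))).
by rewrite mcoeffXU mcoeff0 eqxx.
Qed.

Lemma h_neq0 : h != 0. Proof. exact: variable_neq0. Qed.
Lemma p_neq0 : p != 0. Proof. exact: variable_neq0. Qed.

Lemma pq_neq0 : p + q != 0 :> ZFrac.
Proof.
rewrite /p /q -tofracD tofrac_eq0; apply/eqP => /(congr1 (mcoeff U_(inord 1))).
by rewrite mcoeffD !mcoeffXU mcoeff0 eqxx -val_eqE /= !inordK.
Qed.

Lemma expz_shift (K : fieldType) (x a b : K) (m k : nat) : x != 0 ->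
  x ^+ k * (a * x ^ (m%:Z - k%:Z) * b) = a * x ^+ m * b.
Proof.
move=> x0; rewrite !mulrA [x ^+ k * a]mulrC -!mulrA; congr (_ * _).
by rewrite mulrA -[x ^+ k]/(x ^ k%:Z) -expfzDr // addrCA subrr addr0.
Qed.

Definition word_weight (w : seq nat) : ZFrac := h ^ D w * p ^+ vin31_2 w * q ^+ vin2_13 w.

Lemma weight_word N (s : 'S_N.+1) :
  weight h p q [:: word s] = h ^+ N.+1 * word_weight (word s).
Proof.
have wP : perm_eq (word s) (iota 1 (size (word s))) by rewrite size_word word_perm.
have w0 : (0 < size (word s))%N by rewrite size_word.
rewrite /weight /word_weight occ31_2_vin // occ2_13_vin // !mulrA; congr (_ * _ * _).
have -> : h ^+ drops (padded [:: word s]) = h ^ ((drops (padded [:: word s]))%:Z) by [].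
by rewrite drops_D // size_word addrC expfzDr ?h_neq0.
Qed.

Lemma sum_word_weight v n k :
  \sum_(s : 'S_n.+1 | locally (tree_cond v) (word s) && (des (word s) == k)) word_weight (word s) =
  h ^- n.+1 * total h p q v (iota 1 n.+1) (fun bs => size bs == 1%N)
     (fun d => (d == k.+1)%:R).
Proof.
rewrite /total.
transitivity (h ^- n.+1 * \sum_(bs <- states v (iota 1 n.+1) | size bs == 1%N)
  (fun w => weight h p q [:: w] * (descents (padded [:: w]) == k.+1)%:R) (head [::] bs)); last first.
  congr (_ * _); apply: eq_bigr => bs; by case: bs => [|b []].
rewrite -(sum_states v (fun w => weight h p q [:: w] * (descents (padded [:: w]) == k.+1)%:R)) //.
rewrite mulr_sumr big_mkcondr; apply: eq_bigr => s _.
have wP : perm_eq (word s) (iota 1 (size (word s))) by rewrite size_word word_perm.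
have w0 : (0 < size (word s))%N by rewrite size_word.
rewrite descents_des // eqSS weight_word; case: eqP => _; rewrite ?mulr0 // mulr1 mulrA.
by rewrite mulVf ?mul1r // expf_neq0 ?h_neq0.
Qed.

(** The invariant for one unconstrained block.  A permutation with k descents
    has k + 1 descents in its padded word, one of the factors r compensating
    the width 1 of the pattern. *)
Lemma sum_dd0_andre n k :
  p ^+ k * \sum_(s : 'S_n.+1 | (dd (word s) == 0)%N && (des (word s) == k)) word_weight (word s)
  = (p + q) ^+ k * \sum_(s : 'S_n.+1 | andre2 (word s) && (des (word s) == k)) word_weight (word s).
Proof.
have wP (s : 'S_n.+1) : perm_eq (word s) (iota 1 (size (word s))).
  by rewrite size_word word_perm.
have w0 (s : 'S_n.+1) : (0 < size (word s))%N by rewrite size_word.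
under eq_bigl => s do rewrite dd_locally //.
under [in RHS]eq_bigl => s do rewrite andre2_locally //.
rewrite !sum_word_weight !(mulrCA _ (h ^- _)); congr (_ * _).
pose r := p / (p + q).
have r_def : r * (p + q) = p by rewrite divfK ?pq_neq0.
have r0 : r != 0 by rewrite mulf_eq0 invr_eq0 negb_or (negbTE p_neq0) (negbTE pq_neq0).
have pN : path ltn 0 (iota 1 n.+1) by exact: (iota_ltn_sorted 0 n.+2).
have := total_matches h_neq0 r_def r0 [:: false] (fun d => (d == k.+1)%:R) pN.
rewrite /= mul1r expr1.
have -> : total h p q always (iota 1 n.+1) (fun bs => size bs == 1 + 0)%N
   (fun d => (d == k.+1)%:R * r ^+ d) =
   r * (r ^+ k * total h p q always (iota 1 n.+1) (fun bs => size bs == 1)%N (fun d => (d == k.+1)%:R)).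
  rewrite mulrA -exprS -total_scale; apply: eq_total_r => d.
  by case: eqP => [->|]; rewrite ?mulr0 ?mul0r // mulrC.
rewrite mulrC => /(mulfI r0) E.
have -> : total h p q min_right (iota 1 n.+1) (fun bs => size bs == 1)%N (fun d => (d == k.+1)%:R)
  = total h p q min_right (iota 1 n.+1) (matches [:: false]) (fun d => (d == k.+1)%:R).
  by apply: eq_bigl => -[|b []].
by rewrite E mulrA -exprMn [_ * r]mulrC r_def.
Qed.

Theorem theorem5p5 (n k : nat) (hk : (k <= n./2)%N) :
  tofrac (E n k) =
  \sum_(s : 'S_n.+1 | andre2 (word s) && (des (word s) == k))
     h ^ D (word s)
     * p ^ ((vin31_2 (word s))%:Z - (des (word s))%:Z)
     * q ^+ vin2_13 (word s).
Proof.
have wP (s : 'S_n.+1) : perm_eq (word s) (iota 1 (size (word s))).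
  by rewrite size_word word_perm.
have w0 (s : 'S_n.+1) : (0 < size (word s))%N by rewrite size_word.
(* The exponent of h is D, since drops = D + n + 1. *)
pose P : ZPoly := \sum_(s : 'S_n.+1 | andre2 (word s) && (des (word s) == k))
  'X_(inord 0) ^+ (drops (padded [:: word s]) - n.+1)
  * 'X_(inord 1) ^+ (vin31_2 (word s) - k) * 'X_(inord 2) ^+ vin2_13 (word s).
have PE : tofrac P = \sum_(s : 'S_n.+1 | andre2 (word s) && (des (word s) == k))
     h ^ D (word s)
     * p ^ ((vin31_2 (word s))%:Z - (des (word s))%:Z)
     * q ^+ vin2_13 (word s).
  rewrite /P rmorph_sum; apply: eq_bigr => s /andP[As /eqP ds].
  rewrite !rmorphM !rmorphXn /=; congr (_ * _ * _).
    have Ds := drops_D (wP s) (w0 s); rewrite size_word in Ds.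
    have le : (n.+1 <= drops (padded [:: word s]))%N.
      by have := size_le_drops (wP s) (w0 s); rewrite size_word.
    have -> : D (word s) = (drops (padded [:: word s]) - n.+1)%N%:Z by rewrite -subzn // Ds addrK.
    by [].
  by rewrite subzn ?des_le_vin31 // ds.
suff isP : is_E n k P.
  have isE : is_E n k (E n k) by apply: epsilon_spec; exists P.
  by rewrite (is_E_unique isE isP) PE.
rewrite /is_E PE; apply: (mulfI (expf_neq0 k p_neq0)).
rewrite sum_dd0_andre mulrCA; congr (_ * _); rewrite mulr_sumr.
apply: eq_bigr => s /andP[As /eqP ds].
by rewrite /word_weight ds (expz_shift _ _ _ _ p_neq0).
Qed.
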